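(* Let $n,k\geq1$ and $0\leq s\leq n-1$ be integers. For every real $\lambda\geq0$, the bivariate polynomial \[ \Phi_\lambda(u,v)=\mathcal{F}^k_{n,s}(u,v)+\lambda\bigl(\mathcal{F}^k_{n,s+1}(u,v)-\mathcal{F}^k_{n,s}(u,v)\bigr) \] is real stable.
   Context: For a nonnegative integer $m$, $[m]=\{1,\dots,m\}$ (with $[0]=\varnothing$) is a chain with its usual order; products of chains are ordered coordinatewise. For $0\leq s\leq n$ let \[ P_{n,s}=(\{1\}\times[n])\cup(\{2\}\times[s])\subseteq[2]\times[n] \] with the induced order. An antichain of a poset is a subset whose elements are pairwise incomparable (the empty set included); $\operatorname{Ant}(P)$ is the set of antichains of $P$. Define \[ \mathcal{F}^k_{n,s}(u,v)=\sum_{A\in\operatorname{Ant}([k]\times P_{n,s})}u^{|A\cap([k]\times(\{1\}\times[n]))|}\,v^{|A\cap([k]\times(\{2\}\times[s]))|}, \] where $[k]\times P_{n,s}$ carries the product order. A polynomial with real coefficients in several variables is real stable if it is nonzero whenever all variables lie in the open upper half-plane $\{z\in\mathbb{C}:\operatorname{Im}z>0\}$. *)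

(* Defs.v *)
From mathcomp Require Import all_boot all_order all_algebra.
From mathcomp Require Import reals complex.
From mathcomp Require Import mpoly.

Set Implicit Arguments.
Unset Strict Implicit.
Unset Printing Implicit Defensive.

Import Order.TTheory GRing.Theory Num.Theory.

Local Open Scope ring_scope.

Definition is_antichain (d : Order.disp_t) (T : finPOrderType d)
    (A : {set T}) : bool :=
  [forall x in A, forall y in A, (x != y) ==> (x >< y)%O].

(* A subset S of T carries the induced order, so its antichains are the
   antichains of T that are contained in S. *)
Definition Ant (d : Order.disp_t) (T : finPOrderType d) (S : {set T}) :
    {set {set T}} :=
  [set A : {set T} | (A \subset S) && is_antichain A].

(* The chain [m] = {1, ..., m} is 'I_m = {0, ..., m-1}; *p is the coordinatewise
   order.  For s <= n, [s] is the set of j : 'I_n with j < s. *)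
Definition grid (n : nat) := ('I_2 *p 'I_n)%type.

Definition grid_row1 (n : nat) : {set grid n} :=
  setX [set (0 : 'I_2)] [set: 'I_n].

Definition grid_row2 (n s : nat) : {set grid n} :=
  setX [set (1 : 'I_2)] [set j : 'I_n | (j < s)%N].

Definition Pns (n s : nat) : {set grid n} := grid_row1 n :|: grid_row2 n s.

Definition cube (k n : nat) := ('I_k *p grid n)%type.

Definition chain_prod (k n : nat) (S : {set grid n}) : {set cube k n} :=
  setX [set: 'I_k] S.

(* The variables u and v are 'X_0 and 'X_1. *)
Definition antichain_poly (R : realType) (k n s : nat) : {mpoly R[2]} :=
  \sum_(A in Ant (chain_prod k (Pns n s)))
    'X_(0 : 'I_2) ^+ #|A :&: chain_prod k (grid_row1 n)|
      * 'X_(1 : 'I_2) ^+ #|A :&: chain_prod k (grid_row2 n s)|.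

Definition real_stable (R : realType) (m : nat) (p : {mpoly R[m]}) : Prop :=
  forall z : 'I_m -> R[i],
    (forall i, 0 < complex.Im (z i)) ->
    (map_mpoly (real_complex R) p).@[z] != 0.

Definition Phi (R : realType) (k n s : nat) (lambda : R) : {mpoly R[2]} :=
  antichain_poly R k n s
    + lambda *: (antichain_poly R k n s.+1 - antichain_poly R k n s).

(* Main.v *)
(** Put B_{k,s}(x) = sum_j C(k,j) C(s,j) x^j and
    D_{k,s}(x) = sum_j C(k-1,j-1) C(s+1,j+1) x^j.  The antichain polynomial has
    rank two:
      F^k_{n,s}(u,v) = B_{k,n}(u) B_{k,s}(v) - D_{n,k}(u) D_{k,s}(v).
    This is proved for the more general regions in which the two rows start at
    heights p >= q of the chain [k], by adding one element x at a time: the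
    antichains containing x correspond to the antichains of the elements
    incomparable with x.  The same shape gives
      Phi_lambda = B_{k,n}(u) M(v) - D_{n,k}(u) N(v),
    so it suffices that D_{n,k}/B_{k,n} and N/M map the upper half-plane to
    itself (the former strictly), as the product of their values is then never
    1.  Both ratios are expressed through theta = H/B, with
    H_{k,s}(x) = sum_j C(k,j+1) C(s,j) x^j.  The contiguity relations of B and H
    propagate Im theta < 0 < Im (x theta) by induction on k as long as
    k <= s + 1, and relate theta_{k,s} to theta_{s,k} otherwise. *)

Require Import Defs.
From mathcomp Require Import all_boot all_order all_algebra.
From mathcomp Require Import reals complex.
From mathcomp Require Import mpoly.
From mathcomp Require Import ring lra zify.

Set Implicit Arguments.
Unset Strict Implicit.
Unset Printing Implicit Defensive.

Import Order.TTheory GRing.Theory Num.Theory.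

Local Open Scope ring_scope.

(** * Binomial polynomials and their contiguity relations *)

Section BinomialPolynomials.
Variable F : numFieldType.

Definition binpoly (c d k s : nat) : {poly F} :=
  \poly_(j < k.+1) ('C(k, j + c) * 'C(s, j + d))%:R.

Lemma coef_binpoly c d k s j :
  (binpoly c d k s)`_j = ('C(k, j + c) * 'C(s, j + d))%:R.
Proof.
rewrite coef_poly; case: ltnP => // lt_kj.
by rewrite (@bin_small k) ?mul0n // ltn_addr.
Qed.

Definition Bpoly := binpoly 0 0.
Definition Hpoly := binpoly 1 0.
(* The value at [k = 0] is junk: the formula would need C(-1, j - 1). *)
Definition Dpoly k s : {poly F} :=
  if k is k'.+1 then 'X * binpoly 0 2 k' s.+1 else 0.

Lemma Bpoly_sym k s : Bpoly k s = Bpoly s k.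
Proof. by apply/polyP => j; rewrite !coef_binpoly mulnC. Qed.

Lemma Bpoly0 s : Bpoly 0 s = 1.
Proof.
apply/polyP => j; rewrite coef_binpoly coef1 addn0.
by case: j => [|j]; rewrite ?bin0 // bin0n.
Qed.

Lemma BpolyS k s : Bpoly k s.+1 = Bpoly k s + 'X * Hpoly k s.
Proof.
apply/polyP => -[|j]; rewrite coefD coefXM !coef_binpoly /= ?addn0.
  by rewrite !bin0 addr0.
by rewrite binS addn1 mulnDr natrD.
Qed.

Lemma HpolyS k s : Hpoly k.+1 s = Hpoly k s + Bpoly k s.
Proof.
by apply/polyP => j; rewrite coefD !coef_binpoly addn1 binS addn0 mulnDl natrD.
Qed.

Lemma Hpoly0 s : Hpoly 0 s = 0.
Proof. by apply/polyP => j; rewrite coef_binpoly coef0 addn1 bin0n mul0n. Qed.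

Lemma Hpolyr0 k : Hpoly k 0 = k%:R.
Proof.
elim: k => [|k IH]; first by rewrite Hpoly0.
by rewrite HpolyS IH Bpoly_sym Bpoly0 -natr1.
Qed.

(** By absorption, both sides have j-th coefficient (j+1) C(k+1,j+1) C(s+1,j+1). *)
Lemma Hpoly_diag k s : k.+1%:R *: Hpoly s.+1 k = s.+1%:R *: Hpoly k.+1 s.
Proof.
apply/polyP => j; rewrite !coefZ !coef_binpoly addn1 addn0 -!natrM.
congr (_%:R).
have /= Es := mul_bin_diag s.+1 j; have /= Ek := mul_bin_diag k.+1 j.
by rewrite mulnCA Ek [RHS]mulnCA Es mulnCA [RHS]mulnCA (mulnC 'C(s.+1, _)).
Qed.

(** Multiply the j-th coefficients by j+1 and use (j+1) C(a,j+1) = (a-j) C(a,j); what remains is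
    (s+1)(k-j) = (k-s)(j+1) + (k+1)(s-j). *)
Lemma Hpoly_swap k s :
  s.+1%:R *: Hpoly k s = (k%:R - s%:R) *: Bpoly k s + k.+1%:R *: Hpoly s k.
Proof.
have binE a j : j.+1%:R * 'C(a, j.+1)%:R = (a%:R - j%:R) * 'C(a, j)%:R :> F.
  rewrite -natrM mul_bin_left natrM; have [le_ja|lt_aj] := leqP j a.
    by rewrite natrB.
  by rewrite bin_small ?mulr0.
apply/polyP => j; rewrite coefD !coefZ !coef_binpoly addn0 addn1 !natrM.
apply: (@mulfI F j.+1%:R); first by rewrite pnatr_eq0.
have Es := binE s j; have Ek := binE k j.
transitivity (s.+1%:R * (j.+1%:R * 'C(k, j.+1)%:R) * 'C(s, j)%:R : F).
  by ring.
transitivity ((k%:R - s%:R) * j.+1%:R * 'C(k, j)%:R * 'C(s, j)%:R +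
  k.+1%:R * (j.+1%:R * 'C(s, j.+1)%:R) * 'C(k, j)%:R : F); last by ring.
by rewrite Es Ek -[j.+1]addn1 -[s.+1]addn1 -[k.+1]addn1 !natrD; ring.
Qed.

Lemma Dpolyr0 k : Dpoly k 0 = 0.
Proof.
case: k => // k; apply/polyP => -[|j]; rewrite coefXM coef0 // coef_binpoly /=.
by rewrite (@bin_small 1) ?addn2 // muln0.
Qed.

Lemma DpolySr k s : Dpoly k.+1 s.+1 = Dpoly k.+1 s + 'X * Hpoly s.+1 k.
Proof.
rewrite /= -mulrDr; congr (_ * _); apply/polyP => j.
rewrite coefD !coef_binpoly.
by rewrite addn0 addn1 addn2 (binS s.+1) mulnDr natrD (mulnC 'C(s.+1, j.+1)).
Qed.

Lemma HpolySr k s : Hpoly s.+1 k.+1 = Hpoly s.+1 k + Dpoly k.+1 s.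
Proof.
apply/polyP => -[|j]; rewrite coefD coefXM !coef_binpoly ?bin0 ?addr0 //=.
by rewrite !addn0 addn1 addn2 (binS k) mulnDr natrD (mulnC _ 'C(k, j)).
Qed.

(** This makes D/B an affine function of H/B with real coefficients, so that estimates for H/B
    suffice. *)
Lemma Dpoly_BH k s :
  (k.+1 * k.+2)%:R *: Dpoly k.+1 s =
    s.+1%:R *: (k.+1%:R *: Bpoly k.+1 s - Hpoly k.+1 s).
Proof.
apply/polyP => j; rewrite !coefZ coefB coefZ coefXM !coef_binpoly.
case: j => [|j].
  by rewrite /= !addn0 add0n !bin0 bin1 !muln1 mulr1 subrr !mulr0.
rewrite /= !addn0 addn1 addn2 !natrM.
have /= Es := mul_bin_diag s.+1 j.+1; have /= Ek := mul_bin_diag k.+1 j.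
have /= Ek' := mul_bin_diag k.+1 j.+1.
have {}Es : s.+1%:R * 'C(s, j.+1)%:R = j.+2%:R * 'C(s.+1, j.+2)%:R :> F.
  by rewrite -!natrM Es.
have {}Ek : k.+1%:R * 'C(k, j)%:R = j.+1%:R * 'C(k.+1, j.+1)%:R :> F.
  by rewrite -!natrM Ek.
have {}Ek' : k.+1%:R * 'C(k, j.+1)%:R = j.+2%:R * 'C(k.+1, j.+2)%:R :> F.
  by rewrite -!natrM Ek'.
have Pk : 'C(k, j.+1)%:R = 'C(k.+1, j.+1)%:R - 'C(k, j)%:R :> F.
  by rewrite binS natrD addrK.
transitivity ((k.+1%:R * 'C(k, j)%:R) * k.+2%:R * 'C(s.+1, j.+2)%:R : F).
  by ring.
transitivity ((k.+1%:R * 'C(k.+1, j.+1)%:R - 'C(k.+1, j.+2)%:R) *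
  (s.+1%:R * 'C(s, j.+1)%:R) : F); last by ring.
rewrite Es.
transitivity ((k.+1%:R * j.+2%:R * 'C(k.+1, j.+1)%:R -
   j.+2%:R * 'C(k.+1, j.+2)%:R) * 'C(s.+1, j.+2)%:R : F); last by ring.
congr (_ * _); rewrite -Ek' Pk mulrBr Ek.
by rewrite -[j.+2]addn2 -[j.+1]addn1 -[k.+2]addn2 -[k.+1]addn1 !natrD; ring.
Qed.
End BinomialPolynomials.

(** * The rank-two form and its recurrences *)

Section RankTwoForm.
Variables (F : numFieldType) (u v : F).

(* [P] and [Q] are the numbers of levels of the chain [k] available to the first
   and second row, [m] and [s] the lengths of these rows. *)
Definition rank2 (P Q m s : nat) : F :=
  (Bpoly F P m).[u] * (Bpoly F Q s).[v] - (Dpoly F m P).[u] * (Dpoly F Q s).[v].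

Lemma horner_BpolySr k s x :
  (Bpoly F k s.+1).[x] = (Bpoly F k s).[x] + x * (Hpoly F k s).[x].
Proof. by rewrite BpolyS hornerD hornerM hornerX. Qed.

Lemma horner_BpolySl k s x :
  (Bpoly F k.+1 s).[x] = (Bpoly F k s).[x] + x * (Hpoly F s k).[x].
Proof. by rewrite Bpoly_sym horner_BpolySr (Bpoly_sym _ s). Qed.

Lemma horner_HpolySl k s x :
  (Hpoly F k.+1 s).[x] = (Hpoly F k s).[x] + (Bpoly F k s).[x].
Proof. by rewrite HpolyS hornerD. Qed.

Lemma horner_HpolySr k s x :
  (Hpoly F s.+1 k.+1).[x] =
    (Hpoly F s.+1 k).[x] + (Dpoly F k.+1 s).[x].
Proof. by rewrite HpolySr hornerD. Qed.

Lemma horner_DpolySr k s x :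
  (Dpoly F k.+1 s.+1).[x] = (Dpoly F k.+1 s).[x] + x * (Hpoly F s.+1 k).[x].
Proof. by rewrite DpolySr hornerD [('X * Hpoly _ _ _).[x]]hornerM hornerX. Qed.

Lemma rank2_00 P Q : rank2 P Q 0 0 = 1.
Proof.
rewrite /rank2 (Bpoly_sym _ P) (Bpoly_sym _ Q) !Bpoly0 !hornerC.
by rewrite Dpolyr0 !horner0; ring.
Qed.

(** Mirrors the insertion of one more element, below those already present, into column [m] of the
    first row. *)
Lemma rank2_row1 P Q m s : (s <= m)%N ->
  rank2 P.+1 Q m.+1 s - rank2 P.+1 Q m s =
    rank2 P Q m.+1 s - rank2 P Q m s + u * rank2 P Q m s.
Proof.
rewrite /rank2 horner_BpolySr horner_BpolySr horner_HpolySl.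
(* [Dpoly 0 _] is a junk value here, but [m = 0] forces [s = 0], and the factor [Dpoly Q 0 = 0]
   removes it. *)
case: m => [|m _].
  by rewrite leqn0 => /eqP->; rewrite Dpolyr0 horner0 horner_BpolySl; ring.
rewrite [(Dpoly F m.+2 P.+1).[u]]horner_DpolySr.
by rewrite [(Dpoly F m.+1 P.+1).[u]]horner_DpolySr horner_HpolySr; ring.
Qed.

Definition rank2_diff P Q s : F := rank2 P Q s.+1 s.+1 - rank2 P Q s.+1 s.

Lemma rank2_diff0 s : rank2_diff 0 0 s = 0.
Proof. by rewrite /rank2_diff /rank2 !Bpoly0 /= horner0 !hornerC; ring. Qed.

Lemma rank2_diffSr P Q s : (P <= Q)%N ->
  rank2_diff P Q.+1 s = rank2_diff P Q s + v * rank2 P Q s.+1 s.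
Proof.
rewrite /rank2_diff /rank2 (horner_BpolySr Q.+1) (horner_BpolySr Q).
rewrite horner_HpolySl; case: Q => [|Q _].
  by rewrite leqn0 => /eqP->; rewrite Bpoly_sym Dpolyr0 horner0; ring.
by rewrite (horner_DpolySr Q.+1) (horner_DpolySr Q) horner_HpolySr; ring.
Qed.

(** Combinatorially, an element of the first row on the lowest level lies below the whole new
    column, so an antichain meeting that column avoids it. Algebraically, the two sides differ by u
    v times a determinant of values of [Hpoly s.+1 P] and [Hpoly P.+1 s], which vanishes because
    these polynomials are proportional. *)
Lemma rank2_diff_diag P s : rank2_diff P.+1 P.+1 s = rank2_diff P P.+1 s.
Proof.
have Ediag x : P.+1%:R * (Hpoly F s.+1 P).[x] = s.+1%:R * (Hpoly F P.+1 s).[x].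
  by rewrite -!hornerZ Hpoly_diag.
have E : (Hpoly F s.+1 P).[u] * (Hpoly F P.+1 s).[v]
        = (Hpoly F P.+1 s).[u] * (Hpoly F s.+1 P).[v].
  apply: (@mulfI F P.+1%:R); first by rewrite pnatr_eq0.
  by rewrite mulrA Ediag [RHS]mulrCA Ediag; ring.
rewrite /rank2_diff /rank2 (horner_BpolySr P.+1 _ v) (horner_DpolySr P _ v).
rewrite (horner_BpolySl P _ u) (horner_DpolySr s _ u).
apply/eqP; rewrite -subr_eq0; apply/eqP.
transitivity (u * v * ((Hpoly F s.+1 P).[u] * (Hpoly F P.+1 s).[v]
        - (Hpoly F P.+1 s).[u] * (Hpoly F s.+1 P).[v])); first by ring.
by rewrite E subrr mulr0.
Qed.
End RankTwoForm.

(** * Weighted sums over antichains *)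

Section AntichainSum.
Variables (F : comPzRingType) (d : Order.disp_t) (T : finPOrderType d).
Variable w : T -> F.

Definition antichain_sum (S : {set T}) : F :=
  \sum_(A in Ant S) \prod_(x in A) w x.

Lemma antichain_sum0 : antichain_sum set0 = 1.
Proof.
rewrite /antichain_sum (big_pred1 set0) ?big_set0 // => A.
rewrite inE subset0 /=; case: eqP => // ->.
by apply/forall_inP => x; rewrite inE.
Qed.

Lemma antichain_sumU1 x (S : {set T}) : x \notin S ->
  antichain_sum (x |: S) =
    antichain_sum S + w x * antichain_sum [set y in S | (y >< x)%O].
Proof.
move=> xS; rewrite /antichain_sum (bigID (fun A : {set T} => x \in A)) /=.
rewrite addrC; congr (_ + _).
  apply: eq_bigl => A; rewrite !inE.
  have [xA|xA] := boolP (x \in A); rewrite ?(andbT, andbF).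
    by symmetry; apply/negbTE; rewrite negb_and (contra _ xS) // => /subsetP->.
  congr (_ && _); apply/subsetP/subsetP => sA y yA.
    by have /setU1P[yx|//] := sA y yA; rewrite -yx yA in xA.
  by rewrite inE sA ?orbT.
rewrite mulr_sumr.
rewrite (reindex_onto (fun A => x |: A) (fun A => A :\ x)) /=; last first.
  by move=> A /andP[_ xA]; rewrite setD1K.
apply: eq_big => [A|A /andP[/andP[_ _] /eqP E]]; last first.
  by rewrite big_setU1 // -E !inE eqxx.
rewrite !inE eqxx /= andbT.
apply/andP/andP => [[/andP[sA /forall_inP antA] /eqP E]|[sA /forall_inP antA]].
  have xA : x \notin A by rewrite -E !inE eqxx.
  split; last first.
    apply/forall_inP => y yA; apply/forall_inP => z zA.
    by have /forall_inP -> := antA y (setU1r x yA); rewrite ?setU1r.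
  apply/subsetP => y yA; rewrite inE.
  have nyx : y != x by apply: contraNneq xA => <-.
  have /forall_inP/(_ _ (setU11 _ _))/implyP -> := antA y (setU1r x yA) => //.
  rewrite andbT.
  by have /setU1P[/eqP|//] := subsetP sA y (setU1r x yA); rewrite (negbTE nyx).
have xA : x \notin A.
  by apply: contra xS => /(subsetP sA); rewrite inE => /andP[].
split; last by rewrite setU1K.
apply/andP; split.
  apply: setUS; apply: subset_trans sA _.
  by apply/subsetP => y; rewrite inE => /andP[].
apply/forall_inP => y; rewrite !inE => yA.
apply/forall_inP => z; rewrite !inE => zA.
apply/implyP => nyz.
case/orP: yA nyz => [/eqP->|yA]; case/orP: zA => [/eqP->|zA];
  rewrite ?eqxx // => nyz.
- by have := subsetP sA z zA; rewrite inE comparable_sym => /andP[].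
- by have := subsetP sA y yA; rewrite inE => /andP[].
- by have /forall_inP/(_ _ zA)/implyP-> := antA y yA.
Qed.
End AntichainSum.

(** * Antichain sums over two-row regions *)

Section Regions.
Variables (F : numFieldType) (u v : F) (k n : nat).

Definition weight (x : cube k n) : F := if x.2.1 == 0 then u else v.

(** Each row is given by a predicate on natural numbers, so that equalities of regions become
    arithmetic goals for [lia]. *)
Definition region (f g : nat -> nat -> bool) : {set cube k n} :=
  [set x : cube k n | if x.2.1 == 0 then f x.1 x.2.2 else g x.1 x.2.2].

Lemma eq_region f g f' g' :
  (forall i j, (i < k)%N -> (j < n)%N -> f i j = f' i j) ->
  (forall i j, (i < k)%N -> (j < n)%N -> g i j = g' i j) ->
  region f g = region f' g'.
Proof. by move=> Ef Eg; apply/setP => -[i [r j]]; rewrite !inE Ef // Eg. Qed.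

Lemma comparable_cube (i a : 'I_k) (r e : 'I_2) (j c : 'I_n) :
  (((i, (r, j)) : cube k n) >=< ((a, (e, c)) : cube k n))%O =
  [&& i <= a, r <= e & j <= c]%N || [&& a <= i, e <= r & c <= j]%N.
Proof. by rewrite /Order.comparable !leEprod. Qed.

(** A first-row element is never above a second-row one, so only its upper set is removed from the
    second row. *)
Lemma region_row1 f g t c : (t < k)%N -> (c < n)%N -> ~~ f t c ->
  antichain_sum weight (region (fun i j => f i j || (i == t) && (j == c)) g) =
  antichain_sum weight (region f g) + u * antichain_sum weight
    (region (fun i j => f i j &&
               ~~ ([&& i <= t & j <= c] || [&& t <= i & c <= j])%N)
            (fun i j => g i j && ~~ [&& t <= i & c <= j]%N)).
Proof.
move=> tk cn nf; pose x : cube k n := (Ordinal tk, (0, Ordinal cn)).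
have -> : region (fun i j => f i j || (i == t) && (j == c)) g = x |: region f g.
  apply/setP => -[i [r j]]; rewrite !inE /x /= !xpair_eqE -!val_eqE /=.
  by case: eqP => _ //=; rewrite ?andbF // orbC.
rewrite antichain_sumU1 ?inE //=; congr (_ + _ * antichain_sum _ _).
apply/setP => -[i [r j]]; rewrite !inE /x comparable_cube /= -!val_eqE /=.
by case: r => -[|[|//]] /= _; rewrite ?andbF.
Qed.

Lemma region_row2 f g t c : (t < k)%N -> (c < n)%N -> ~~ g t c ->
  antichain_sum weight (region f (fun i j => g i j || (i == t) && (j == c))) =
  antichain_sum weight (region f g) + v * antichain_sum weight
    (region (fun i j => f i j && ~~ [&& i <= t & j <= c]%N)
            (fun i j => g i j &&
               ~~ ([&& i <= t & j <= c] || [&& t <= i & c <= j])%N)).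
Proof.
move=> tk cn ng; pose x : cube k n := (Ordinal tk, (1, Ordinal cn)).
have -> : region f (fun i j => g i j || (i == t) && (j == c)) = x |: region f g.
  apply/setP => -[i [r j]]; rewrite !inE /x /= !xpair_eqE -!val_eqE /=.
  by case: r => -[|[|//]] /= _; rewrite ?andbF // orbC.
rewrite antichain_sumU1 ?inE //=; congr (_ + _ * antichain_sum _ _).
apply/setP => -[i [r j]]; rewrite !inE /x comparable_cube /= -!val_eqE /=.
by case: r => -[|[|//]] /= _; rewrite ?andbF ?orbF.
Qed.

Definition corner p q m s : {set cube k n} :=
  region (fun i j => (p <= i) && (j < m))%N (fun i j => (q <= i) && (j < s))%N.

(** All [p] and [q] are needed at once: deleting the elements comparable with an inserted one leaves
    a corner whose rows start at other levels. *)
Definition cornerP m s := forall p q, (q <= p <= k)%N ->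
  antichain_sum weight (corner p q m s) = rank2 u v (k - p) (k - q) m s.

Lemma corner00 : cornerP 0 0.
Proof.
move=> p q _; rewrite rank2_00 -[RHS](antichain_sum0 weight).
congr antichain_sum.
by apply/setP => x; rewrite !inE !andbF if_same.
Qed.

(** Since [s <= m], the new column is incomparable with the whole second row; an insertion only
    raises the starting level of the first. *)
Lemma corner_row1 m s : (s <= m < n)%N -> cornerP m s -> cornerP m.+1 s.
Proof.
move=> /andP[sm mn] IH p q /andP[qp pk].
(* The last column is filled from the top: [S D] contains its [D] largest
   elements. *)
pose S D := region
  (fun i j => (p <= i) && (j < m) || (k - D <= i) && (j == m))%N
  (fun i j => (q <= i) && (j < s))%N.
have main D : (D <= k - p)%N -> antichain_sum weight (S D) =
   rank2 u v (k - p) (k - q) m s +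
     (rank2 u v D (k - q) m.+1 s - rank2 u v D (k - q) m s).
  elim: D => [_|D IHD lD].
    have -> : S 0%N = corner p q m s.
      by apply: eq_region => i j ik jn //; rewrite subn0 (leqNgt k) ik orbF.
    by rewrite IH ?qp // /rank2 !Bpoly0 !hornerC; case: m {IH S sm mn} => [|m];
      rewrite ?Dpolyr0 ?horner0; ring.
  have -> : S D.+1 = region
    (fun i j => ((p <= i) && (j < m) || (k - D <= i) && (j == m)) ||
       (i == k - D.+1) && (j == m))%N (fun i j => (q <= i) && (j < s))%N.
    by apply: eq_region => i j ik jn //; lia.
  rewrite region_row1 ?IHD; try lia.
  rewrite [X in u * antichain_sum _ X](_ : _ = corner (k - D) q m s);
    last by apply: eq_region => i j ik jn; lia.
  rewrite IH; last by lia.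
  rewrite subKn; last by lia.
  by rewrite rank2_row1 //; ring.
have -> : corner p q m.+1 s = S (k - p)%N.
  by apply: eq_region => i j ik jn //; lia.
by rewrite main //; ring.
Qed.

Lemma corner_row2 s : (s < n)%N -> cornerP s.+1 s -> cornerP s.+1 s.+1.
Proof.
move=> sn IH p q /andP[qp pk].
pose S D := region (fun i j => (p <= i) && (j < s.+1))%N
  (fun i j => (q <= i) && (j < s) || (k - D <= i) && (j == s))%N.
(* An antichain meeting the [D] new elements can use only levels of the first row from [k - D] on;
   there are [minn (k - p) D] of them. *)
have main D : (D <= k - q)%N -> antichain_sum weight (S D) =
   rank2 u v (k - p) (k - q) s.+1 s + rank2_diff u v (minn (k - p) D) D s.
  elim: D => [_|D IHD lD].
    have -> : S 0%N = corner p q s.+1 s.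
      by apply: eq_region => i j ik jn //; rewrite subn0 (leqNgt k) ik orbF.
    by rewrite IH ?qp // minn0 rank2_diff0 addr0.
  have -> : S D.+1 = region (fun i j => (p <= i) && (j < s.+1))%N
    (fun i j => ((q <= i) && (j < s) || (k - D <= i) && (j == s))
     || (i == k - D.+1) && (j == s))%N.
    by apply: eq_region => i j ik jn //; lia.
  rewrite region_row2 ?IHD; try lia.
  rewrite [X in v * antichain_sum _ X]
    (_ : _ = corner (maxn p (k - D)) (k - D) s.+1 s);
    last by apply: eq_region => i j ik jn; lia.
  rewrite IH; last by lia.
  have -> : (k - maxn p (k - D) = minn (k - p) D)%N by lia.
  rewrite subKn; last by lia.
  rewrite -[LHS]addrA; congr (_ + _); rewrite -rank2_diffSr ?geq_minr //.
  (* Either the first row is already exhausted, or one more of its levels comes into range and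
     [rank2_diff_diag] shows that it contributes nothing. *)
  have [le|lt] : (k - p <= D)%N \/ (D < k - p)%N by lia.
    have -> : minn (k - p) D = (k - p)%N by lia.
    by have -> : minn (k - p) D.+1 = (k - p)%N by lia.
  have -> : minn (k - p) D = D by lia.
  have -> : minn (k - p) D.+1 = D.+1 by lia.
  by rewrite rank2_diff_diag.
have -> : corner p q s.+1 s.+1 = S (k - q)%N.
  by apply: eq_region => i j ik jn //; lia.
have -> : rank2 u v (k - p) (k - q) s.+1 s.+1 =
  rank2 u v (k - p) (k - q) s.+1 s +
  rank2_diff u v (k - p) (k - q) s by rewrite /rank2_diff; ring.
by rewrite main // (minn_idPl _) //; lia.
Qed.

(** The second row is lengthened to [s.+1] only when the first has length exactly [s.+1]; every
    other step lengthens the first row. *)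
Lemma antichain_sum_corner m s : (s <= m <= n)%N -> cornerP m s.
Proof.
elim: s m => [|s IHs] m.
  elim: m => [|m IHm] mn; first exact: corner00.
  by apply: corner_row1; [lia | apply: IHm; lia].
elim: m => [|m IHm] smn; first by lia.
have [ms|ms] := eqVneq s m; last by apply: corner_row1; [lia | apply: IHm; lia].
by rewrite -ms; apply: corner_row2; [lia | apply: IHs; lia].
Qed.
End Regions.

(** * Half-plane estimates for the ratio of H to B *)

Section Stieltjes.
Variable R : realType.
Implicit Types (x y z v th : R[i]) (c : R).
Local Notation Im := complex.Im.
Local Notation Re := complex.Re.
Local Notation "c %:C" := (real_complex R c).

Lemma ImD x y : Im (x + y) = Im x + Im y. Proof. by case: x y => [? ?] []. Qed.
Lemma ImN x : Im (- x) = - Im x. Proof. by case: x. Qed.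
Lemma ImC c : Im c%:C = 0. Proof. by []. Qed.
Lemma ImZ c x : Im (c%:C * x) = c * Im x.
Proof. by case: x => a b /=; rewrite mul0r addr0. Qed.
Lemma ImV x : Im x^-1 = - Im x / (Re x ^+ 2 + Im x ^+ 2).
Proof. by case: x => a b /=; rewrite mulNr. Qed.

Lemma ImV_gt0 x : (0 < Im x^-1) = (Im x < 0).
Proof.
have [->|x0] := eqVneq x 0; first by rewrite invr0 ltxx.
rewrite ImV pmulr_lgt0 ?oppr_gt0 // invr_gt0 lt_neqAle.
rewrite addr_ge0 ?sqr_ge0 // andbT.
apply: contra x0; rewrite eq_sym paddr_eq0 ?sqr_ge0 // !sqrf_eq0.
by case: x => a b /= /andP[/eqP-> /eqP->].
Qed.

Lemma ImV_lt0 x : (Im x^-1 < 0) = (0 < Im x).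
Proof. by rewrite -ImV_gt0 invrK. Qed.
Lemma ImV_ge0 x : (0 <= Im x^-1) = (Im x <= 0).
Proof. by rewrite leNgt ImV_lt0 -leNgt. Qed.
Lemma ImV_le0 x : (Im x^-1 <= 0) = (0 <= Im x).
Proof. by rewrite leNgt ImV_gt0 -leNgt. Qed.

Lemma Im_gt0_neq0 x : 0 < Im x -> x != 0.
Proof. by apply: contraTneq => ->; rewrite ltxx. Qed.

(** The reciprocal of the new ratio is c v + 1/(1 + th) + 1/(1/v + 1/(v th)), whose terms have
    nonnegative imaginary part, the last a positive one. Divided by v it is c + 1 - 1/(1 + th) +
    1/(v (1 + th)), with negative imaginary part. *)
Lemma stieltjes_step v th c :
  0 <= c -> 0 < Im v -> Im th <= 0 -> 0 < Im (v * th) ->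
  let d := 1 + v * (c%:C * (1 + th) + th) in
  [/\ d != 0, Im ((1 + th) / d) < 0 & 0 < Im (v * ((1 + th) / d))].
Proof.
move=> c0 v0 th0 vth0 /=; set d := 1 + _.
have vn := Im_gt0_neq0 v0; have vthn := Im_gt0_neq0 vth0.
have thn : th != 0 by apply: contraNneq vthn => ->; rewrite mulr0.
have s0 : 0 < Im (v * (1 + th)) by rewrite mulrDr mulr1 ImD addr_gt0.
have sn : 1 + th != 0.
  by apply: contraTneq s0 => ->; rewrite mulr0 ltxx.
have is0 : 0 <= Im (1 + th)^-1 by rewrite ImV_ge0 ImD ImC add0r.
have E1 : d / (1 + th) = c%:C * v + (1 + th)^-1 + (v^-1 + (v * th)^-1)^-1.
  rewrite /d; field.
  by rewrite vn thn addrC sn.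
have d0 : 0 < Im (d / (1 + th)).
  rewrite E1 !ImD ImZ ltr_wpDl // ?addr_ge0 ?mulr_ge0 // ?ltW //.
  by rewrite ImV_gt0 ImD -oppr_gt0 opprD addr_gt0 ?oppr_gt0 ?ImV_lt0.
have dn : d != 0 by apply: contraTneq d0 => ->; rewrite mul0r ltxx.
split=> //; first by rewrite -ImV_gt0 invf_div.
rewrite -ImV_lt0 invfM invf_div.
have -> : v^-1 * (d / (1 + th)) = c%:C + 1 - (1 + th)^-1 + (v * (1 + th))^-1.
  by rewrite /d; field; rewrite sn vn.
have := ImV_lt0 (v * (1 + th)); rewrite s0 !ImD ImN !ImC.
by move: is0; lra.
Qed.

Definition theta k s v : R[i] := (Hpoly _ k s).[v] / (Bpoly _ k s).[v].

(** The two inequalities are those satisfied at [v] in the upper half-plane by the Stieltjes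
    transform of a nonzero positive measure on the positive half-line. *)
Definition stieltjes v k s : Prop :=
  [/\ (Bpoly R[i] k s).[v] != 0, Im (theta k s v) < 0 &
      0 < Im (v * theta k s v)].

Lemma theta_swap k s v : (Bpoly _ k s).[v] != 0 ->
  s.+1%:R * theta k s v = (k%:R - s%:R) + k.+1%:R * theta s k v.
Proof.
rewrite /theta (Bpoly_sym _ s k) => B0; rewrite !mulrA.
have := congr1 (horner^~ v) (Hpoly_swap R[i] k s).
rewrite hornerD !hornerZ => ->; field; exact: B0.
Qed.

Lemma natr_complex m : m%:R = (m%:R : R)%:C :> R[i].
Proof. by rewrite rmorph_nat. Qed.

(** By [theta_swap] the two ratios differ by positive scalings and a shift by k - s >= 0, which
    leaves Im theta negative and can only increase Im (v theta). *)
Lemma stieltjes_swap k s v : (s <= k)%N -> 0 < Im v ->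
  stieltjes v s k -> stieltjes v k s.
Proof.
move=> sk v0 [B0 h1 h2]; rewrite Bpoly_sym in B0.
have E := theta_swap B0; rewrite -natrB // !natr_complex in E.
have s0 : (0 : R) < s.+1%:R by rewrite ltr0n.
have k0 : (0 : R) < k.+1%:R by rewrite ltr0n.
split=> //.
  by rewrite -(pmulr_rlt0 _ s0) -ImZ E ImD ImC add0r ImZ pmulr_rlt0.
rewrite -(pmulr_rgt0 _ s0) -ImZ mulrCA E mulrDr [v * (_%:C)%C]mulrC.
rewrite [v * (_ * _)]mulrCA.
by rewrite ImD !ImZ ltr_wpDl ?pmulr_rgt0 // mulr_ge0 // ltW.
Qed.

(** Eliminating [theta s k] by [theta_swap] gives the map of [stieltjes_step] with c = (s - k)/(k +
    1), nonnegative because [k <= s]. *)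
Lemma thetaS k s v : (k <= s)%N -> (Bpoly _ k s).[v] != 0 ->
  theta k.+1 s v = (1 + theta k s v) /
    (1 + v * (((s - k)%:R / k.+1%:R)%:C * (1 + theta k s v) + theta k s v)) /\
  (Bpoly _ k.+1 s).[v] = (Bpoly _ k s).[v] *
    (1 + v * (((s - k)%:R / k.+1%:R)%:C * (1 + theta k s v) + theta k s v)).
Proof.
move=> ks B0.
have k0 : k.+1%:R != 0 :> R[i] by rewrite pnatr_eq0.
have Ec : ((s - k)%:R / k.+1%:R)%:C * (1 + theta k s v) + theta k s v =
    theta s k v.
  apply: (mulfI k0); rewrite rmorphM fmorphV !rmorph_nat.
  have := theta_swap B0; rewrite natrB // -[s.+1]addn1 -[k.+1]addn1 !natrD => E.
  have -> : (k%:R + 1) * theta s k v = (s%:R + 1) * theta k s v - (k%:R - s%:R).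
    by rewrite E; ring.
  by field; rewrite natr1.
have EB : (Bpoly R[i] k.+1 s).[v] =
    (Bpoly R[i] k s).[v] * (1 + v * theta s k v).
  by rewrite horner_BpolySl /theta (Bpoly_sym _ s k); field.
rewrite Ec; split=> //.
rewrite {1}/theta EB horner_HpolySl invfM mulrA; congr (_ / _).
by rewrite mulrDl divff // addrC.
Qed.

Lemma stieltjes_le k s v :
  0 < Im v -> (0 < s)%N -> (k <= s)%N -> stieltjes v k.+1 s.
Proof.
(* The induction starts from theta_{1,s} = 1/(1 + s v), as theta_{0,s} = 0 fails the strict
   inequalities. *)
move=> v0 s0; elim: k => [_|k IH ks].
  have H0 : (Hpoly R[i] s 0).[v] = s%:R by rewrite Hpolyr0 -polyC_natr hornerC.
  have d0 : 0 < Im (1 + v * s%:R).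
    by rewrite ImD ImC add0r natr_complex mulrC ImZ mulr_gt0 // ltr0n.
  have dn := Im_gt0_neq0 d0; have vn := Im_gt0_neq0 v0.
  rewrite /stieltjes /theta horner_BpolySl Bpoly0 hornerC H0.
  rewrite horner_HpolySl Hpoly0 horner0 Bpoly0 hornerC add0r.
  split=> //; first by rewrite div1r ImV_lt0.
  rewrite div1r -ImV_lt0 invfM invrK mulrDr mulr1 mulKf // natr_complex.
  by rewrite ImD ImC addr0 ImV_lt0.
have [B0 h1 h2] := IH (ltnW ks).
have [Et EB] := thetaS ks B0.
have c0 : 0 <= (s - k.+1)%:R / k.+2%:R :> R by rewrite divr_ge0.
have [d0 g1 g2] := stieltjes_step c0 v0 (ltW h1) h2.
by rewrite /stieltjes Et EB; split=> //; apply: mulf_neq0.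
Qed.

Lemma stieltjes_gt0 k s v :
  0 < Im v -> (0 < k)%N -> (0 < s)%N -> stieltjes v k s.
Proof.
move=> v0; case: k => // k _ s0.
have [ks|sk] := leqP k s; first exact: stieltjes_le.
apply: stieltjes_swap => //; first lia.
case: s s0 sk => // s _ sk; apply: stieltjes_le => //; lia.
Qed.

(** For [s = 0] the ratio is the real constant [k], so the first inequality is no longer strict. *)
Lemma stieltjes_weak k s v : 0 < Im v -> (0 < k)%N ->
  [/\ (Bpoly R[i] k s).[v] != 0, Im (theta k s v) <= 0 &
      0 < Im (v * theta k s v)].
Proof.
move=> v0 k0; case: (posnP s) => [->|s0]; last first.
  by have [? /ltW] := stieltjes_gt0 v0 k0 s0.
rewrite /theta Hpolyr0 Bpoly_sym Bpoly0 hornerC -polyC_natr hornerC invr1 mulr1.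
rewrite natr_complex.
by rewrite oner_eq0 ImC lexx mulrC ImZ mulr_gt0 // ltr0n.
Qed.

(* With M = 1 + l v th, the bracket N multiplying c a satisfies
   N / M = kk + 1 - 1 / M - 1 / (1 / th + l v), which has Im >= 0. *)
Lemma half_plane_neq0 v th a c kk l :
  0 < Im v -> Im th <= 0 -> 0 < Im (v * th) ->
  0 < Im a -> 0 < c -> 0 <= l ->
  1 + l%:C * (v * th) -
    c%:C * a * (kk%:C - th + (kk%:C + 1) * (l%:C * (v * th))) != 0.
Proof.
move=> v0 th0 x0 a0 c0 l0; set N := _ - _ + _; set M := 1 + _.
have thn : th != 0 by apply: contraTneq x0 => ->; rewrite mulr0 ltxx.
have M0 : 0 <= Im M by rewrite ImD ImC add0r ImZ mulr_ge0 // ltW.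
have Mn : M != 0.
  have [l_eq0|ln] := eqVneq l 0; first by rewrite /M l_eq0 mul0r addr0 oner_eq0.
  by apply: Im_gt0_neq0; rewrite ImD ImC add0r ImZ mulr_gt0 // lt0r ln.
have NM : 0 <= Im (N / M).
  have -> : N / M = (kk + 1)%:C - M^-1 - (th^-1 + l%:C * v)^-1.
    have -> : th^-1 + l%:C * v = M / th by rewrite /M; field.
    by rewrite rmorphD rmorph1 invf_div /N -[_%:C * _](addKr 1) -/M; field.
  rewrite !ImD !ImN ImC add0r -opprD oppr_ge0 -[leRHS]addr0.
  by rewrite lerD // ImV_le0 // ImD ImZ addr_ge0 ?ImV_ge0 // mulr_ge0 // ltW.
(* A zero would give N / M = 1/(c a), which lies in the open lower half-plane. *)
rewrite subr_eq0; apply: contraTneq NM => E.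
rewrite -ltNge.
have ca0 : 0 < Im (c%:C * a) by rewrite ImZ mulr_gt0.
have can := Im_gt0_neq0 ca0.
have -> : N / M = (c%:C * a)^-1.
  apply: (mulfI can); rewrite divff // mulrA -E divff //.
by rewrite ImV_lt0.
Qed.
End Stieltjes.

(** * Evaluation of the antichain polynomials and real stability *)

Lemma corner_chain_prod (k n s : nat) : (s <= n)%N ->
  chain_prod k (Pns n s) = corner k n 0 0 n s.
Proof.
move=> sn; apply/setP => -[i [r j]]; rewrite !inE /= ltn_ord.
by case: r => -[|[|//]].
Qed.

Lemma antichain_poly_eval (R : realType) (k n s : nat) (z : 'I_2 -> R[i]) :
  (s <= n)%N ->
  (map_mpoly (real_complex R) (antichain_poly R k n s)).@[z] =
  rank2 (z 0) (z 1) k k n s.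
Proof.
move=> sn; rewrite /antichain_poly [map_mpoly _ _]rmorph_sum rmorph_sum /=.
have := @antichain_sum_corner _ (z 0) (z 1) k n n s.
rewrite sn leqnn /= => /(_ isT 0%N 0%N); rewrite leq0n /= => /(_ isT).
rewrite -corner_chain_prod // !subn0 => <-.
apply: eq_bigr => A; rewrite inE => /andP[/subsetP sA _].
rewrite [map_mpoly _ _]rmorphM !rmorphXn /=.
rewrite !map_mpolyX rmorphM !rmorphXn /= !mevalXU -!prodr_const.
rewrite [RHS](bigID (fun x : cube k n => x.2.1 == 0)) /=; congr (_ * _).
  apply: eq_big => [x|x]; rewrite !inE /weight.
    by case: (x \in A) => //=; rewrite andbT.
  by case: (x.2.1 == 0); rewrite ?andbF.
apply: eq_big => [x|x]; rewrite !inE /weight.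
  case xA: (x \in A) => //=; have := sA x xA; rewrite !inE /=.
  by case: (x) => i [[[|[|//]] lr] j].
by case: x => i [[[|[|//]] lr] j] //=; rewrite !andbF.
Qed.

Theorem theorem3p4 (R : realType) (n k s : nat)
  (hn : (1 <= n)%N) (hk : (1 <= k)%N) (hs : (s <= n - 1)%N)
  (lambda : R) (hlambda : 0 <= lambda) :
  real_stable (Phi k n s lambda).
Proof.
move=> z z0; rewrite /Phi.
have sn : (s < n)%N by lia.
rewrite [map_mpoly _ _]rmorphD /= map_mpolyZ (rmorphB (map_mpoly _)) /=.
rewrite mevalD mevalZ mevalB !antichain_poly_eval // ?(ltnW sn) //.
have u0 := z0 0; have v0 := z0 1.
move: (z 0) (z 1) u0 v0 => u v u0 v0 {z z0}.
case: k hk => // k _; case: n sn {hn hs} => // n sn.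
rewrite /rank2 (horner_BpolySr k.+1 s v) (horner_DpolySr k s v).
have [BU0 aU _] := stieltjes_gt0 u0 (ltn0Sn n) (ltn0Sn k).
have [BV0 tV xV] := stieltjes_weak s v0 (ltn0Sn k).
set th := theta k.+1 s v in tV xV.
set al := theta n.+1 k.+1 u in aU.
have HV : (Hpoly _ k.+1 s).[v] = th * (Bpoly _ k.+1 s).[v] by rewrite divfK.
have HU : (Hpoly _ n.+1 k.+1).[u] = al * (Bpoly _ n.+1 k.+1).[u].
  by rewrite divfK.
have n0 a : a.+1%:R != 0 :> R[i] by rewrite pnatr_eq0.
have DE a b w : (Dpoly R[i] a.+1 b).[w] = b.+1%:R / (a.+1%:R * a.+2%:R) *
    (a.+1%:R * (Bpoly _ a.+1 b).[w] - (Hpoly _ a.+1 b).[w]).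
  have := congr1 (horner^~ w) (Dpoly_BH R[i] a b).
  rewrite !hornerZ hornerD hornerN hornerZ natrM => E.
  apply: (mulfI (mulf_neq0 (n0 a) (n0 a.+1))); rewrite E; field.
  by rewrite nat1r -natrD !pnatr_eq0.
have HE : (Hpoly _ s.+1 k).[v] = s.+1%:R / k.+1%:R * (Hpoly R[i] k.+1 s).[v].
  have := congr1 (horner^~ v) (Hpoly_diag R[i] k s); rewrite !hornerZ => E.
  by apply: (mulfI (n0 k)); rewrite E; field; rewrite nat1r n0.
rewrite HE !DE HU HV (Bpoly_sym _ k.+1 n.+1).
(* [c] is the product of the two prefactors given by [DE], for u and for v. Taking B_{n+1,k+1}(u)
   B_{k+1,s}(v) out of the value of Phi leaves the expression of [half_plane_neq0] with a = n + 1 -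
   al and kk = k + 1. *)
pose c : R := s.+1%:R * k.+2%:R / (k.+1%:R * k.+2%:R * n.+1%:R * n.+2%:R).
have c0 : 0 < c by rewrite divr_gt0 // !mulr_gt0 ?ltr0n.
have a0 : 0 < complex.Im (n.+1%:R - al).
  by rewrite natr_complex ImD ImN ImC add0r oppr_gt0.
have := half_plane_neq0 k.+1%:R v0 tV xV a0 c0 hlambda.
rewrite /c !(rmorphM, fmorphV) /= !rmorph_nat => br.
set BU := (Bpoly _ n.+1 k.+1).[u] in BU0 *.
set BV := (Bpoly _ k.+1 s).[v] in BV0 *.
have := mulf_neq0 (mulf_neq0 BU0 BV0) br.
congr (_ != 0); set L := real_complex R lambda; field.
by rewrite !nat1r -!natrD !pnatr_eq0.
Qed.
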